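(* Let $k$ be a field, let $J$ be a small category and let $F : J \to k\text{-CoAlg}$ be a functor. Let $\bigl(\prod_{j \in J} F(j), (p_j)_{j \in J}\bigr)$ and $\bigl(\prod_{u \in \mathrm{Hom}(J)} F(\mathrm{cod}(u)), (p_u)_{u \in \mathrm{Hom}(J)}\bigr)$ be the products in $k\text{-CoAlg}$ of the families $(F(j))_{j \in J}$ and $(F(\mathrm{cod}(u)))_{u \in \mathrm{Hom}(J)}$, respectively. Let $f, g : \prod_{j \in J} F(j) \to \prod_{u \in \mathrm{Hom}(J)} F(\mathrm{cod}(u))$ be the unique coalgebra maps such that $p_u \circ f = p_{\mathrm{cod}(u)}$ and $p_u \circ g = F(u) \circ p_{\mathrm{dom}(u)}$ for all $u \in \mathrm{Hom}(J)$. Define $$D = \Bigl\{ x \in \prod_{j \in J} F(j) \;\Big|\; x_{(1)} \otimes f(x_{(2)}) \otimes x_{(3)} = x_{(1)} \otimes g(x_{(2)}) \otimes x_{(3)} \Bigr\}$$ and let $e : D \to \prod_{j \in J} F(j)$ be the canonical inclusion. Then the pair $\bigl(D, (\varphi_j = p_j \circ e)_{j \in J}\bigr)$, where $D$ carries the coalgebra structure induced from $\prod_{j \in J} F(j)$, is the limit of the functor $F$ in $k\text{-CoAlg}$.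
   Context: $k\text{-CoAlg}$ denotes the category of coassociative counital coalgebras over the field $k$ with coalgebra maps as morphisms; all products $\prod$ in the claim are categorical products in $k\text{-CoAlg}$ (which exist), not products of vector spaces. Tensor products are over $k$. Sweedler's notation is used: $\Delta(x) = x_{(1)} \otimes x_{(2)}$ and $(\mathrm{Id} \otimes \Delta)\Delta(x) = x_{(1)} \otimes x_{(2)} \otimes x_{(3)}$, summation understood. For a small category $J$, the index $j \in J$ runs over the objects of $J$, $\mathrm{Hom}(J)$ is the set of all morphisms of $J$, and for a morphism $u$, $\mathrm{dom}(u)$ and $\mathrm{cod}(u)$ are its domain and codomain. *)

(* Defs.v *)
From HB Require Import structures.
From mathcomp Require Import all_boot all_algebra.
From mathcomp Require Import generic_quotient ring_quotient sesquilinear boolp.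
From mathcomp.multinomials Require Import freeg.

Set Implicit Arguments.
Unset Strict Implicit.
Unset Printing Implicit Defensive.

Import GRing.Theory.
Local Open Scope ring_scope.
Local Open Scope quotient_scope.

Declare Scope cat_scope.
Delimit Scope cat_scope with cat.

Reserved Notation "v ⊗ w" (at level 40, left associativity).
Reserved Notation "g ∘ f" (at level 40, left associativity).

(* -------------------------------------------------------------------------- *)
(* Linear extension to the free module on a set. *)

Lemma fglift_is_linear (k : nzRingType) (M : lmodType k) (T : choiceType)
  (f : T -> M) : linear (fglift f).
Proof.
have fgB : {morph fglift f : x y / x - y} by exact: lift_is_additive.
have fg0 : fglift f 0 = 0 by rewrite -(subrr 0) fgB subrr.
have fgN x : fglift f (- x) = - fglift f x by rewrite -[- x]add0r fgB fg0 add0r.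
have fgD x y : fglift f (x + y) = fglift f x + fglift f y.
  by rewrite -[y]opprK fgB fgN !opprK.
have fgS (I : Type) (r : seq I) (F : I -> {freeg T / k}) :
    fglift f (\sum_(i <- r) F i) = \sum_(i <- r) fglift f (F i).
  by elim: r => [|i r IH]; rewrite ?big_nil // !big_cons fgD IH.
move=> a x y; rewrite fgD; congr (_ + _).
rewrite -[X in _ = _ *: fglift f X](freeg_sumE x) fgS scaler_sumr.
have -> : a *: x = \sum_(z <- freeg.dom x) << a * coeff z x *g z >> by [].
by rewrite fgS; apply: eq_bigr => z _; rewrite !liftU scalerA.
Qed.

HB.instance Definition _ (k : nzRingType) (M : lmodType k) (T : choiceType)
  (f : T -> M) :=
  GRing.isLinear.Build k {freeg T / k} M *:%R (fglift f) (fglift_is_linear f).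

Lemma freegZU (k : nzRingType) (T : choiceType) (a : k) (x : T) :
  << a *g x >> = a *: << x >> :> {freeg T / k}.
Proof.
have -> : a *: << x >> = \sum_(z <- freeg.dom (<< x >> : {freeg T / k}))
  << a * coeff z << x >> *g z >> by [].
by rewrite domU1 big_seq1 coeffU eqxx !mulr1.
Qed.

(* -------------------------------------------------------------------------- *)
(* The tensor product over k: the free module on V * W modulo the submodule   *)
(* generated by the bilinearity relations.                                    *)

Section TensorDef.
Variables (k : fieldType) (V W : lmodType k).
Local Notation freeVW := {freeg (V * W)%type / k}.
Local Notation gen v w := (<< (v, w) >> : freeVW).

Inductive tensor_gen : freeVW -> Prop :=
| tensor_genl a v v' w :
    tensor_gen (gen (a *: v + v') w - (a *: gen v w + gen v' w))
| tensor_genr a v w w' :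
    tensor_gen (gen v (a *: w + w') - (a *: gen v w + gen v w')).

Definition tensor_rel : {pred freeVW} := fun z =>
  `[< forall S : {pred freeVW},
        submod_closed S -> (forall r, tensor_gen r -> r \in S) -> z \in S >].

Lemma tensor_rel_submod : submod_closed tensor_rel.
Proof.
split=> [|a x y /asboolP hx /asboolP hy].
  by apply/asboolP => S [].
by apply/asboolP => S hS hr; apply: hS.2; [exact: hx | exact: hy].
Qed.

HB.instance Definition _ :=
  GRing.isSubmodClosed.Build k freeVW tensor_rel tensor_rel_submod.

Lemma tensor_gen_rel r : tensor_gen r -> r \in tensor_rel.
Proof. by move=> hr; apply/asboolP => S _; apply. Qed.

Definition tensor := Quotient.quot tensor_rel.

HB.instance Definition _ := GRing.Zmodule.on tensor.

Local Notation cl := (\pi_tensor : freeVW -> tensor).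

Lemma tensor_piP (x y : freeVW) : reflect (cl x = cl y) (x - y \in tensor_rel).
Proof. by rewrite Quotient.idealrBE; exact: eqP. Qed.

Lemma tensor_piD x y : cl (x + y) = cl x + cl y.
Proof. by rewrite !piE. Qed.

Lemma tensor_reprK (x : tensor) : cl (repr x) = x.
Proof. exact: reprK. Qed.

Lemma tensor_pi0 : cl 0 = 0.
Proof. by apply: (addrI (cl 0)); rewrite -tensor_piD !addr0. Qed.

Definition tensor_scale (a : k) (x : tensor) : tensor := cl (a *: repr x).

Lemma tensor_piZ a x : tensor_scale a (cl x) = cl (a *: x).
Proof.
apply/tensor_piP; rewrite -scalerBr; apply: rpredZ.
by apply/tensor_piP; rewrite reprK.
Qed.

Lemma tensor_scaleA a b v :
  tensor_scale a (tensor_scale b v) = tensor_scale (a * b) v.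
Proof. by rewrite -[v]tensor_reprK !tensor_piZ scalerA. Qed.

Lemma tensor_scale1 : left_id 1 tensor_scale.
Proof. by move=> v; rewrite -[v]tensor_reprK tensor_piZ scale1r. Qed.

Lemma tensor_scaleDr : right_distributive tensor_scale +%R.
Proof.
move=> a u v; rewrite -[u]tensor_reprK -[v]tensor_reprK -tensor_piD !tensor_piZ -tensor_piD.
by rewrite scalerDr.
Qed.

Lemma tensor_scaleDl v : {morph tensor_scale^~ v : a b / a + b}.
Proof.
by move=> a b; rewrite -[v]tensor_reprK !tensor_piZ -tensor_piD scalerDl.
Qed.

HB.instance Definition _ := GRing.Zmodule_isLmodule.Build k tensor
  tensor_scaleA tensor_scale1 tensor_scaleDr tensor_scaleDl.

Definition tens (v : V) (w : W) : tensor := cl (gen v w).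

Lemma tens_bilinear : bilinear_for *:%R *:%R tens.
Proof.
split=> [w a v v'|v a w w'].
  transitivity (cl (a *: gen v w + gen v' w)).
    by apply/tensor_piP/tensor_gen_rel; left.
  by rewrite tensor_piD -tensor_piZ.
transitivity (cl (a *: gen v w + gen v w')).
  by apply/tensor_piP/tensor_gen_rel; right.
by rewrite tensor_piD -tensor_piZ.
Qed.

HB.instance Definition _ :=
  bilinear_isBilinear.Build k V W tensor *:%R *:%R tens tens_bilinear.

End TensorDef.

Notation "v ⊗ w" := (tens v w) : ring_scope.

Section TensorUniversal.
Variables (k : fieldType) (V W U : lmodType k).

Section Lift.
Variable B : V -> W -> U.
Hypothesis Bbil : bilinear_for *:%R *:%R B.

Let phi : {linear {freeg (V * W)%type / k} -> U} :=
  fglift (fun vw => B vw.1 vw.2).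

Let phiU v w : phi << (v, w) >> = B v w.
Proof. by rewrite /phi /= liftU scale1r. Qed.

Definition tlift_fun of bilinear_for *:%R *:%R B : tensor V W -> U :=
  fun x => phi (repr x).

Lemma phi_rel z : z \in @tensor_rel k V W -> phi z = 0.
Proof.
move/asboolP/(_ [pred z | phi z == 0]) => h; apply/eqP; apply: h.
  split=> [|a x y]; rewrite !inE; first by rewrite linear0.
  by move=> /eqP hx /eqP hy; rewrite linearP hx hy scaler0 addr0.
case: Bbil => Bl Br.
move=> r [a v v' w|a v w w']; rewrite inE linearB ![phi (_ *: _ + _)]linearP !phiU.
  by rewrite (Bl w a v v') subrr.
by rewrite (Br v a w w') subrr.
Qed.

Lemma tlift_pi z : tlift_fun Bbil (\pi_(tensor V W) z) = phi z.
Proof.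
apply/eqP; rewrite -subr_eq0 /tlift_fun -linearB; apply/eqP/phi_rel.
by apply/tensor_piP; rewrite reprK.
Qed.

Lemma tlift_is_linear : linear (tlift_fun Bbil).
Proof.
move=> a x y.
have -> : a *: x + y = \pi_(tensor V W) (a *: repr x + repr y).
  by rewrite tensor_piD -tensor_piZ !tensor_reprK.
by rewrite tlift_pi linearP.
Qed.

HB.instance Definition _ :=
  GRing.isLinear.Build k (tensor V W) U *:%R (tlift_fun Bbil) tlift_is_linear.

Definition tlift : {linear tensor V W -> U} := tlift_fun Bbil.

Arguments tlift : simpl never.

Lemma tliftE v w : tlift (v ⊗ w) = B v w.
Proof. exact: etrans (tlift_pi _) (phiU _ _). Qed.

End Lift.

Lemma tensor_sum (x : tensor V W) : exists s : seq (V * W),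
  x = \sum_(vw <- s) vw.1 ⊗ vw.2.
Proof.
have [s hs] : exists s : seq (k * (V * W)), repr x = [freeg s].
  by exists (repr (repr x)); rewrite freeg_repr.
exists [seq (t.1 *: t.2.1, t.2.2) | t <- s].
rewrite big_map -[x]tensor_reprK hs {x hs}.
elim: s => [|[a [v w]] s IH]; first by rewrite big_nil freeg_nil tensor_pi0.
rewrite big_cons -IH -cat1s freeg_cat tensor_piD; congr (_ + _) => /=.
by rewrite linearZl_LR /= freegZU -tensor_piZ.
Qed.

Lemma tensor_ext (f g : {linear tensor V W -> U}) :
  (forall v w, f (v ⊗ w) = g (v ⊗ w)) -> f =1 g.
Proof.
move=> fg x; have [s ->] := tensor_sum x.
by rewrite !linear_sum; apply: eq_bigr.
Qed.

End TensorUniversal.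

Section TensorMaps.
Variable k : fieldType.

Section Tmap.
Variables (V V' W W' : lmodType k).
Variables (f : {linear V -> V'}) (g : {linear W -> W'}).

Lemma tmap_bilinear : bilinear_for *:%R *:%R (fun v w => f v ⊗ g w).
Proof.
by split=> [w a v v'|v a w w'] /=; rewrite linearP ?linearPl ?linearPr.
Qed.

Definition tmap : {linear tensor V W -> tensor V' W'} := tlift tmap_bilinear.

Arguments tmap : simpl never.

Lemma tmapE v w : tmap (v ⊗ w) = f v ⊗ g w.
Proof. exact: tliftE. Qed.

End Tmap.

Section Tassoc.
Variables U V W : lmodType k.

Lemma tassoc_bilinear_aux (w : W) :
  bilinear_for *:%R *:%R (fun (u : U) (v : V) => u ⊗ (v ⊗ w)).
Proof.
by split=> [v a u u'|u a v v'] /=; rewrite ?linearPl ?linearPr.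
Qed.

Lemma tassoc_bilinear : bilinear_for *:%R *:%R
  (fun (t : tensor U V) (w : W) => tlift (tassoc_bilinear_aux w) t).
Proof.
split=> [w a t t'|t a w w'] /=; first by rewrite linearP.
have [s ->] := tensor_sum t.
rewrite !linear_sum -big_split /=; apply: eq_bigr => -[u v] _ /=.
by rewrite !tliftE !linearPr.
Qed.

Definition tassoc : {linear tensor (tensor U V) W -> tensor U (tensor V W)} :=
  tlift tassoc_bilinear.

Arguments tassoc : simpl never.

Lemma tassocE u v w : tassoc ((u ⊗ v) ⊗ w) = u ⊗ (v ⊗ w).
Proof. by rewrite /tassoc tliftE tliftE. Qed.

End Tassoc.

Lemma tmap_comp (V V' V'' W W' W'' : lmodType k)
  (f : {linear V -> V'}) (f' : {linear V' -> V''})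
  (g : {linear W -> W'}) (g' : {linear W' -> W''}) x :
  tmap (f' \o f) (g' \o g) x = tmap f' g' (tmap f g x).
Proof.
move: x; apply: (tensor_ext (g := tmap f' g' \o tmap f g)) => v w.
by rewrite [RHS]/= !tmapE.
Qed.

Lemma tmap_id (V W : lmodType k) (x : tensor V W) : tmap idfun idfun x = x.
Proof. by move: x; apply: (tensor_ext (g := idfun)) => v w; rewrite tmapE. Qed.

End TensorMaps.

(* -------------------------------------------------------------------------- *)

(* No smallness is imposed on a diagram category: below, the products over its
   objects and morphisms are given as data. *)
Record category := Category {
  obj :> Type;
  mor : obj -> obj -> Type;
  idm : forall a, mor a a;
  compm : forall a b c, mor b c -> mor a b -> mor a c;
  compm1 : forall a b (f : mor a b), compm f (idm a) = f;
  comp1m : forall a b (f : mor a b), compm (idm b) f = f;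
  compmA : forall a b c d (h : mor c d) (g : mor b c) (f : mor a b),
    compm h (compm g f) = compm (compm h g) f
}.

Arguments idm {_} a.

Notation "g ∘ f" := (compm g f) : cat_scope.
Local Open Scope cat_scope.

(* The morphisms of C, all hom-sets taken together. *)
Record arrow (C : category) := Arrow {
  dom : C;
  cod : C;
  arrow_mor :> mor dom cod
}.

Record functor (C D : category) := Functor {
  fobj :> C -> D;
  fmap : forall a b, mor a b -> mor (fobj a) (fobj b);
  fmap1 : forall a, fmap (idm a) = idm (fobj a);
  fmapM : forall a b c (g : mor b c) (f : mor a b),
    fmap (g ∘ f) = fmap g ∘ fmap f
}.

Definition is_product (C : category) (I : Type) (X : I -> C) (P : C)
    (p : forall i, mor P (X i)) : Prop :=
  forall (Y : C) (h : forall i, mor Y (X i)),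
    exists! t : mor Y P, forall i, p i ∘ t = h i.

Definition is_cone (J C : category) (F : functor J C) (L : C)
    (phi : forall j, mor L (F j)) : Prop :=
  forall (a b : J) (u : mor a b), fmap F u ∘ phi a = phi b.

Definition is_limit (J C : category) (F : functor J C) (L : C)
    (phi : forall j, mor L (F j)) : Prop :=
  is_cone phi /\
  forall (Y : C) (psi : forall j, mor Y (F j)), is_cone psi ->
    exists! t : mor Y L, forall j, phi j ∘ t = psi j.

(* -------------------------------------------------------------------------- *)

(* In the counit laws x in C corresponds to 1 ⊗ x in k ⊗ C and x ⊗ 1 in C ⊗ k. *)
Record coalg_struct (k : fieldType) (C : lmodType k) := CoalgStruct {
  comul : {linear C -> tensor C C};
  counit : {linear C -> k^o};
  comulA : forall x,
    tassoc C C C (tmap comul idfun (comul x)) = tmap idfun comul (comul x);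
  counitl : forall x, tmap counit idfun (comul x) = (1 : k^o) ⊗ x;
  counitr : forall x, tmap idfun counit (comul x) = x ⊗ (1 : k^o)
}.

Record coalg (k : fieldType) := Coalg {
  coalg_space :> lmodType k;
  coalg_str :> coalg_struct coalg_space
}.

Definition is_coalg_map (k : fieldType) (C D : lmodType k)
    (sC : coalg_struct C) (sD : coalg_struct D) (f : {linear C -> D}) : Prop :=
  (forall x, tmap f f (comul sC x) = comul sD (f x)) /\
  (forall x, counit sD (f x) = counit sC x).

Record coalg_hom (k : fieldType) (C D : coalg k) := CoalgHom {
  coalg_fun :> {linear C -> D};
  coalg_funP : is_coalg_map C D coalg_fun
}.

Lemma linear_ext (k : fieldType) (C D : lmodType k) (f g : {linear C -> D}) :
  f =1 g -> f = g.
Proof.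
case: f g => [f [[pf] [qf]]] [g [[pg] [qg]]] /= /funext fg; subst g.
by rewrite (Prop_irrelevance pf pg) (Prop_irrelevance qf qg).
Qed.

Lemma coalg_hom_ext (k : fieldType) (C D : coalg k) (f g : coalg_hom C D) :
  f =1 g -> f = g.
Proof.
case: f g => [f pf] [g pg] /= /linear_ext fg; subst g.
by rewrite (Prop_irrelevance pf pg).
Qed.

Section CoalgCategory.
Variable k : fieldType.

Lemma coalg_id_subproof (C : coalg k) : is_coalg_map C C idfun.
Proof. by split=> x //=; rewrite tmap_id. Qed.

Definition coalg_id (C : coalg k) : coalg_hom C C :=
  CoalgHom (coalg_id_subproof C).

Lemma coalg_comp_subproof (A B C : coalg k)
  (g : coalg_hom B C) (f : coalg_hom A B) : is_coalg_map A C (g \o f).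
Proof.
have [g1 g2] := coalg_funP g; have [f1 f2] := coalg_funP f.
by split=> x /=; rewrite ?tmap_comp ?f1 ?g1 ?g2 ?f2.
Qed.

Definition coalg_comp (A B C : coalg k)
    (g : coalg_hom B C) (f : coalg_hom A B) : coalg_hom A C :=
  CoalgHom (coalg_comp_subproof g f).

Lemma coalg_compm1 (A B : coalg k) (f : coalg_hom A B) :
  coalg_comp f (coalg_id A) = f.
Proof. exact: coalg_hom_ext. Qed.

Lemma coalg_comp1m (A B : coalg k) (f : coalg_hom A B) :
  coalg_comp (coalg_id B) f = f.
Proof. exact: coalg_hom_ext. Qed.

Lemma coalg_compA (A B C D : coalg k) (h : coalg_hom C D) (g : coalg_hom B C)
  (f : coalg_hom A B) :
  coalg_comp h (coalg_comp g f) = coalg_comp (coalg_comp h g) f.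
Proof. exact: coalg_hom_ext. Qed.

Definition CoAlg : category :=
  Category coalg_compm1 coalg_comp1m coalg_compA.

End CoalgCategory.

(* -------------------------------------------------------------------------- *)

Section SweedlerEqualizer.
Variables (k : fieldType) (P Q : coalg k) (f g : coalg_hom P Q).

(* x_(1) ⊗ x_(2) ⊗ x_(3) *)
Definition comul3 : {linear P -> tensor P (tensor P P)} :=
  tmap idfun (comul P) \o comul P.

(* x_(1) ⊗ h(x_(2)) ⊗ x_(3) *)
Definition sweedler_mid (h : {linear P -> Q}) :
    {linear P -> tensor P (tensor Q P)} :=
  tmap idfun (tmap h idfun) \o comul3.

Definition sweedler_eq_pred : {pred P} :=
  fun x => sweedler_mid f x == sweedler_mid g x.

Lemma sweedler_eq_submod : submod_closed sweedler_eq_pred.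
Proof.
rewrite /sweedler_eq_pred; split=> [|a x y]; rewrite !unfold_in ?linear0 //.
by move=> /eqP hx /eqP hy; rewrite !linearP hx hy.
Qed.

HB.instance Definition _ :=
  GRing.isSubmodClosed.Build k P sweedler_eq_pred sweedler_eq_submod.

Definition sweedler_eq : Type := {x : P | x \in sweedler_eq_pred}.

HB.instance Definition _ := SubChoice.on sweedler_eq.
HB.instance Definition _ := [SubChoice_isSubLmodule of sweedler_eq by <:].

(* The coalgebra structure induced from P on this subspace is the one for which
   the inclusion is a coalgebra map. *)
Definition sweedler_eq_incl : {linear sweedler_eq -> P} := val.

End SweedlerEqualizer.

(* Main.v *)
From HB Require Import structures.
Require Import Defs.
From mathcomp Require Import all_boot all_algebra.
From mathcomp Require Import sesquilinear boolp classical_sets.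

Set Implicit Arguments.
Unset Strict Implicit.
Unset Printing Implicit Defensive.

Import GRing.Theory.
Local Open Scope ring_scope.
Local Open Scope cat_scope.

(** For a linear map h : P -> Q write M_h x = x_(1) ⊗ h(x_(2)) ⊗ x_(3); then
    D is the kernel of M = M_f - M_g.

    D is a subcoalgebra.  By coassociativity, both (M_h ⊗ id) Δ x and
    (id ⊗ M_h) Δ x are images of M_h x under linear maps that do not depend on
    h ([sweedler_mid_comull], [sweedler_mid_comulr]): apply Δ to the last,
    respectively the first, factor of M_h x.  Hence for x in D both M ⊗ id and
    id ⊗ M kill Δ x.  Over a field, M has a generalized inverse s, i.e.
    M s M = M ([exists_pseudoinverse]), and pi = 1 - s M is a projection of P
    onto D; the two vanishings say that pi ⊗ id and id ⊗ pi fix Δ x, so Δ x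
    lies in the image of D ⊗ D ([sweedler_eq_retraction]).  This argument
    contains the equality (ker M ⊗ P) ∩ (P ⊗ ker M) = ker M ⊗ ker M.
    Corestricting pi gives a retraction r of the inclusion e, so all tensor
    powers of e are split injections.  The comultiplication (r ⊗ r) Δ e and the
    counit ε e then satisfy the coalgebra laws because they do so after
    applying these injections, and no other structure makes e a coalgebra map
    ([subcoalgebra_exists], [coalg_struct_uniq]).

    D is the equalizer of f and g.  Applying ε to the two outer factors of
    M_h x gives h x, so f and g agree on D ([sweedler_eq_equalizes]).
    Conversely, if t is a coalgebra map into P with f t = g t, then M_h (t y) =
    t(y_(1)) ⊗ h(t(y_(2))) ⊗ t(y_(3)) takes the same value for h = f and h = g,
    so t takes its values in D ([sweedler_eq_lift]).

    The limit property follows as in any category with the products at hand: a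
    cone over F is a map t into P, and compatibility with the arrows u amounts
    to q_u f t = q_u g t for all u, that is, to f t = g t. *)

(** * Generalized inverses of linear maps *)

Section LinearAlgebra.
Variable k : fieldType.

Definition lin_closed (V : lmodType k) (A : set V) : Prop :=
  forall a x y, A x -> A y -> A (a *: x + y).

Definition meets_trivially (V : lmodType k) (U A : set V) : Prop :=
  forall x, A x -> U x -> x = 0.

(** By Zorn's lemma take A maximal among the linearly closed sets meeting U
    trivially.  If no w in A had v - w in U, then the sums c v + w with w in A
    would form a larger such set. *)
Lemma exists_complement (V : lmodType k) (U : set V) :
    U 0 -> lin_closed U ->
  exists A : set V, [/\ A 0, lin_closed A, meets_trivially U A &
    forall v, exists2 w, A w & U (v - w)].
Proof.
move=> U0 UL.
have [|A [[AL AU] Amax]] :=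
    @Zorn_bigcup V (fun A => lin_closed A /\ meets_trivially U A).
  move=> F FP Ftot; split=> [a x y [X FX Xx] [Y FY Yy]|x [X FX Xx]]; last first.
    exact: (FP X FX).2.
  have [XY|YX] := Ftot X Y FX FY.
    by exists Y => //; apply: (FP Y FY).1 => //; apply: XY.
  by exists X => //; apply: (FP X FX).1 => //; apply: YX.
have A0 : A 0.
  (* The empty set is linearly closed here, which serves the empty chain; the
     maximal A is not empty since the zero subspace is also a candidate. *)
  apply: contrapT => nA0.
  have nA x : ~ A x.
    by move=> Ax; apply: nA0; have := AL (-1) x x Ax Ax; rewrite scaleN1r addNr.
  apply: (Amax (fun x => x = 0)).
    by split=> [x /nA //|/(_ 0 erefl)].
  split=> [a x y -> ->|x -> //]; by rewrite scaler0 addr0.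
have AZ a x : A x -> A (a *: x).
  by move=> Ax; have := AL a x 0 Ax A0; rewrite addr0.
have UZ a x : U x -> U (a *: x).
  by move=> Ux; have := UL a x 0 Ux U0; rewrite addr0.
exists A; split=> // v; apply: contrapT => nv.
apply: (Amax (fun x => exists c w, A w /\ x = c *: v + w)).
  split=> [x Ax|/(_ v) h].
    by exists 0, x; rewrite scale0r add0r.
  apply: nv; exists v; last by rewrite subrr.
  by apply: h; exists 1, 0; rewrite scale1r addr0.
split=> [a x y [c [w [Aw ->]]] [c' [w' [Aw' ->]]]|x [c [w [Aw ->]]]].
  exists (a * c + c'), (a *: w + w'); split; first exact: AL.
  by rewrite scalerDr scalerA scalerDl addrACA.
have [->|c0] := eqVneq c 0; first by rewrite scale0r add0r; exact: AU.
move=> Ucvw; case: nv; exists (- c^-1 *: w); first exact: AZ.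
by rewrite -[v in v - _](scalerK c0) scaleNr opprK -scalerDr; exact: UZ.
Qed.

(** Let A be a complement of U and w v the A-component of v; the projection is
    1 - w. *)
Lemma exists_projection (V : lmodType k) (U : set V) :
    U 0 -> lin_closed U ->
  exists pi : {linear V -> V},
    (forall v, U (pi v)) /\ (forall u, U u -> pi u = u).
Proof.
move=> U0 UL; have [A [A0 AL AU Aex]] := exists_complement U0 UL.
have [|w wP] := @choice _ _ (fun v w => A w /\ U (v - w)).
  by move=> v; have [w] := Aex v; exists w.
have w_uniq v x : A x -> U (v - x) -> w v = x.
  have [Aw Uw] := wP v => Ax Ux; apply/eqP; rewrite -subr_eq0; apply/eqP/AU.
    by rewrite -scaleN1r addrC; exact: AL.
  have -> : w v - x = -1 *: (v - w v) + (v - x).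
    by rewrite scaleN1r opprB addrA subrK.
  exact: UL.
have wL : linear w.
  move=> a x y; have [Ax Ux] := wP x; have [Ay Uy] := wP y; apply: w_uniq.
    exact: AL.
  by rewrite opprD addrACA -scalerBr; exact: UL.
pose W : {linear V -> V} := HB.pack w (GRing.isLinear.Build k V V *:%R w wL).
exists (idfun \- W); split=> v /=; first by have [] := wP v.
by move=> Uv; rewrite (w_uniq v 0) ?subr0.
Qed.

(** With pi a projection onto the kernel of M and rho one onto its image, send y
    to l - pi l for any l with M l = rho y.  Two choices of l differ by an
    element of the kernel, so the result is independent of l and linear in y. *)
Lemma exists_pseudoinverse (V W : lmodType k) (M : {linear V -> W}) :
  exists s : {linear W -> V}, forall x, M (s (M x)) = M x.
Proof.
have [||pi [piK piid]] := @exists_projection V (fun x => M x = 0).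
- by rewrite /= linear0.
- by move=> a x y /= Mx My; rewrite linearP Mx My scaler0 addr0.
have [||rho [rhoM rhoid]] := @exists_projection W (fun y => exists x, M x = y).
- by exists 0; rewrite linear0.
- by move=> a _ _ [x <-] [y <-]; exists (a *: x + y); rewrite linearP.
have [//|l lP] := @choice _ _ (fun y x => M x = rho y).
have sE y x : M x = rho y -> l y - pi (l y) = x - pi x.
  move=> Mx; apply: subr0_eq; rewrite opprD addrACA -opprD -linearB piid ?subrr //.
  by rewrite linearB lP Mx subrr.
have sL : linear (fun y => l y - pi (l y)).
  move=> a y z; rewrite (sE _ (a *: l y + l z)); last by rewrite !linearP !lP.
  by rewrite linearP opprD addrACA scalerBr.
pose s : {linear W -> V} := HB.pack (fun y => l y - pi (l y))
  (GRing.isLinear.Build k W V *:%R _ sL).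
exists s => x; rewrite /= linearB /= lP (piK (l _)) subr0.
by rewrite rhoid //; exists x.
Qed.

End LinearAlgebra.

(** * Maps between tensor products *)

Section TensorLemmas.
Variable k : fieldType.

(** The composites h and i are given only up to pointwise equality, so that a
    structural identity such as a counit law can serve as a side condition. *)
Lemma tmap_compE (V V' V'' W W' W'' : lmodType k)
    (f : {linear V -> V'}) (f' : {linear V' -> V''}) (h : {linear V -> V''})
    (g : {linear W -> W'}) (g' : {linear W' -> W''}) (i : {linear W -> W''}) :
    (forall v, f' (f v) = h v) -> (forall w, g' (g w) = i w) ->
  forall x, tmap f' g' (tmap f g x) = tmap h i x.
Proof.
move=> fh gi x; rewrite -tmap_comp.
by apply: tensor_ext x => v w; rewrite !tmapE /= fh gi.
Qed.

Lemma eq_tmap (V V' W W' : lmodType k)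
    (f f' : {linear V -> V'}) (g g' : {linear W -> W'}) :
  f =1 f' -> g =1 g' -> tmap f g =1 tmap f' g'.
Proof. by move=> ff gg; apply: tensor_ext => v w; rewrite !tmapE ff gg. Qed.

Lemma tmap_cancel (V V' W W' : lmodType k)
    (f : {linear V -> V'}) (f' : {linear V' -> V})
    (g : {linear W -> W'}) (g' : {linear W' -> W}) :
  cancel f f' -> cancel g g' -> cancel (tmap f g) (tmap f' g').
Proof.
by move=> ff gg x; rewrite (tmap_compE (h := idfun) (i := idfun)) ?tmap_id.
Qed.

Lemma tmapBl (V V' W W' : lmodType k)
    (f g : {linear V -> V'}) (h : {linear W -> W'}) x :
  tmap (f \- g) h x = tmap f h x - tmap g h x.
Proof.
move: x; apply: (tensor_ext (g := tmap f h \- tmap g h)) => v w.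
by rewrite [RHS]/= !tmapE linearBl.
Qed.

Lemma tmapBr (V V' W W' : lmodType k)
    (h : {linear V -> V'}) (f g : {linear W -> W'}) x :
  tmap h (f \- g) x = tmap h f x - tmap h g x.
Proof.
move: x; apply: (tensor_ext (g := tmap h f \- tmap h g)) => v w.
by rewrite [RHS]/= !tmapE linearBr.
Qed.

Lemma tassoc_nat (U V W U' V' W' : lmodType k) (f : {linear U -> U'})
    (g : {linear V -> V'}) (h : {linear W -> W'}) x :
  tassoc U' V' W' (tmap (tmap f g) h x) = tmap f (tmap g h) (tassoc U V W x).
Proof.
have [s ->] := tensor_sum x; rewrite !linear_sum; apply: eq_bigr => -[y w] _ /=.
have [t ->] := tensor_sum y; rewrite linear_sumlz !linear_sum.
by apply: eq_bigr => -[u v] _; rewrite /= !(tmapE, tassocE).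
Qed.

(** An inverse of the associator, to transport identities of comultiplications
    back across a reassociation. *)
Section InverseAssociator.
Variables U V W : lmodType k.

Lemma tassocV_bilinear_aux (u : U) :
  bilinear_for *:%R *:%R (fun (v : V) (w : W) => (u ⊗ v) ⊗ w).
Proof.
split=> [w a v v'|v a w w'] /=; last exact: linearPr.
by rewrite linearPr linearPl.
Qed.

Lemma tassocV_bilinear : bilinear_for *:%R *:%R
  (fun (u : U) (t : tensor V W) => tlift (tassocV_bilinear_aux u) t).
Proof.
split=> [t a u u'|u a t t'] /=; last exact: linearP.
have [s ->] := tensor_sum t.
rewrite !linear_sum -big_split /=; apply: eq_bigr => -[v w] _ /=.
by rewrite !tliftE !linearPl.
Qed.

Definition tassocV : {linear tensor U (tensor V W) -> tensor (tensor U V) W} :=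
  tlift tassocV_bilinear.

Lemma tassocK : cancel (tassoc U V W) tassocV.
Proof.
move=> x; have [s ->] := tensor_sum x; rewrite !linear_sum.
apply: eq_bigr => -[y w] _ /=.
have [t ->] := tensor_sum y; rewrite linear_sumlz !linear_sum.
by apply: eq_bigr => -[u v] _; rewrite tassocE /tassocV !tliftE.
Qed.

End InverseAssociator.

Section Contraction.
Variable V : lmodType k.

Lemma contractl_bilinear :
  bilinear_for *:%R *:%R (fun (c : k^o) (v : V) => c *: v).
Proof.
split=> [v a b c|c a v w] /=; first by rewrite scalerDl scalerA.
by rewrite scalerDr !scalerA mulrC.
Qed.

Lemma contractr_bilinear :
  bilinear_for *:%R *:%R (fun (v : V) (c : k^o) => c *: v).
Proof. by case: contractl_bilinear. Qed.

Definition contractl : {linear tensor k^o V -> V} := tlift contractl_bilinear.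
Definition contractr : {linear tensor V k^o -> V} := tlift contractr_bilinear.

Lemma contractl1 v : contractl ((1 : k^o) ⊗ v) = v.
Proof. by rewrite /contractl tliftE scale1r. Qed.

Lemma contractr1 v : contractr (v ⊗ (1 : k^o)) = v.
Proof. by rewrite /contractr tliftE scale1r. Qed.

End Contraction.

End TensorLemmas.

(** * Subcoalgebras *)

Section Subcoalgebra.
Variables (k : fieldType) (P : coalg k) (D : lmodType k).
Variables (e : {linear D -> P}) (r : {linear P -> D}).
Hypothesis eK : cancel e r.

(* A retraction passes to tensor powers, whereas injectivity alone does so only
   by flatness; the proofs below cancel e ⊗ e and its variants in this way. *)
Let tmap_e_inj : injective (tmap e e).
Proof. exact: can_inj (tmap_cancel eK eK). Qed.

Lemma coalg_struct_uniq (s s' : coalg_struct D) :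
  is_coalg_map s P e -> is_coalg_map s' P e -> s = s'.
Proof.
move=> [s1 s2] [s1' s2'].
have dd : comul s = comul s'.
  by apply: linear_ext => x; apply: tmap_e_inj; rewrite s1 s1'.
have ee : counit s = counit s' by apply: linear_ext => x; rewrite -s2 -s2'.
case: s s' dd ee {s1 s2 s1' s2'} => [d c a l r0] [d' c' a' l' r0'] /= dd cc.
subst d' c'.
by rewrite (Prop_irrelevance a a') (Prop_irrelevance l l')
  (Prop_irrelevance r0 r0').
Qed.

(* Δ maps the image of e into the image of e ⊗ e. *)
Hypothesis stab : forall d,
  tmap e e (tmap r r (comul P (e d))) = comul P (e d).

Let dD : {linear D -> tensor D D} := tmap r r \o (comul P \o e).
Let cD : {linear D -> k^o} := counit P \o e.

Let dDE d : tmap e e (dD d) = comul P (e d).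
Proof. exact: stab. Qed.

(* After e ⊗ (e ⊗ e) both sides become the two sides of coassociativity of P at
   e x. *)
Let dDA x : tassoc D D D (tmap dD idfun (dD x)) = tmap idfun dD (dD x).
Proof.
apply: (can_inj (tmap_cancel eK (tmap_cancel eK eK))).
rewrite -tassoc_nat.
rewrite (tmap_compE (h := comul P \o e) (i := e)) //.
rewrite -(tmap_compE (f := e) (f' := comul P) (g := e) (g' := idfun)) //.
rewrite dDE comulA.
rewrite [RHS](tmap_compE (h := e) (i := comul P \o e)) //.
rewrite -(tmap_compE (f := e) (f' := idfun) (g := e) (g' := comul P)) //.
by rewrite dDE.
Qed.

Let cDl x : tmap cD idfun (dD x) = (1 : k^o) ⊗ x.
Proof.
apply: (can_inj (tmap_cancel (f := idfun) (f' := idfun) (frefl _) eK)).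
rewrite tmapE (tmap_compE (h := cD) (i := e)) //.
rewrite -(tmap_compE (f := e) (f' := counit P) (g := e) (g' := idfun)) //.
by rewrite dDE counitl.
Qed.

Let cDr x : tmap idfun cD (dD x) = x ⊗ (1 : k^o).
Proof.
apply: (can_inj (tmap_cancel (g := idfun) (g' := idfun) eK (frefl _))).
rewrite tmapE (tmap_compE (h := e) (i := cD)) //.
rewrite -(tmap_compE (f := e) (f' := idfun) (g := e) (g' := counit P)) //.
by rewrite dDE counitr.
Qed.

Lemma subcoalgebra_exists : exists s : coalg_struct D, is_coalg_map s P e.
Proof. by exists (CoalgStruct dDA cDl cDr); split=> x //; exact: dDE. Qed.

End Subcoalgebra.

(** * The map x |-> x_(1) ⊗ h(x_(2)) ⊗ x_(3) *)

Section SweedlerMid.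
Variables (k : fieldType) (P : coalg k) (Q : coalg k).
Implicit Type h : {linear P -> Q}.

(* x_(1) ⊗ h(x_(2)) and h(x_(1)) ⊗ x_(2) *)
Let snd_map h : {linear P -> tensor P Q} := tmap idfun h \o comul P.
Let mid_map h : {linear P -> tensor Q P} := tmap h idfun \o comul P.

Let sweedler_mid_def h x : sweedler_mid h x =
  tmap idfun (tmap h idfun) (tmap idfun (comul P) (comul P x)).
Proof. by []. Qed.

Let sweedler_midE_right h x :
  sweedler_mid h x = tmap idfun (mid_map h) (comul P x).
Proof.
by rewrite sweedler_mid_def (tmap_compE (h := idfun) (i := mid_map h)).
Qed.

Let sweedler_midE_left h x :
  sweedler_mid h x = tassoc P Q P (tmap (snd_map h) idfun (comul P x)).
Proof.
rewrite sweedler_mid_def -comulA -tassoc_nat.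
by rewrite (tmap_compE (h := snd_map h) (i := idfun)).
Qed.

(** Both sides are x_(1) ⊗ (x_(2) ⊗ (h(x_(3)) ⊗ x_(4))): by coassociativity the
    comultiplication that splits off x_(1) may be performed last. *)
Lemma sweedler_mid_comulr h x :
  tmap idfun (sweedler_mid h) (comul P x) =
  tassoc P P (tensor Q P) (tmap (comul P) idfun (sweedler_mid h x)).
Proof.
rewrite sweedler_midE_right (tmap_compE (h := comul P) (i := mid_map h)) //.
rewrite -(tmap_compE (f := comul P) (f' := tmap idfun idfun)
  (g := idfun) (g' := mid_map h)) //; last by move=> v; rewrite tmap_id.
rewrite tassoc_nat comulA.
by rewrite (tmap_compE (h := idfun) (i := sweedler_mid h)).
Qed.

(** Both sides are (x_(1) ⊗ (h(x_(2)) ⊗ x_(3))) ⊗ x_(4), the comultiplication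
    being applied last to the third factor on the right; the associators only
    move the brackets. *)
Lemma sweedler_mid_comull h x :
  tmap (sweedler_mid h) idfun (comul P x) =
  tmap (tassoc P Q P) idfun (tassocV _ _ _ (tmap idfun (comul P)
    (tassocV _ _ _ (sweedler_mid h x)))).
Proof.
rewrite [in RHS](sweedler_midE_left h x).
rewrite (tassocK (tmap (snd_map h) idfun (comul P x))).
rewrite [in RHS](tmap_compE (h := snd_map h) (i := comul P)) //.
rewrite -(tmap_compE (f := idfun) (f' := snd_map h)
  (g := comul P) (g' := tmap idfun idfun)) //; last by move=> v; rewrite tmap_id.
rewrite -comulA -tassoc_nat.
rewrite (tassocK (tmap (tmap (snd_map h) idfun) idfun
  (tmap (comul P) idfun (comul P x)))).
rewrite (tmap_compE (h := tmap (snd_map h) idfun \o comul P) (i := idfun)) //.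
rewrite (tmap_compE (h := sweedler_mid h) (i := idfun)) // => w.
by rewrite sweedler_midE_left.
Qed.

(** This gives t(y_(1)) ⊗ h(t(y_(2))) ⊗ t(y_(3)), in which h enters only through
    the composite of h and t. *)
Lemma sweedler_mid_nat (Y : coalg k) (t : coalg_hom Y P) h y :
  sweedler_mid h (t y) =
  tmap t (tmap (h \o t) t) (tmap idfun (comul Y) (comul Y y)).
Proof.
have [tD _] := coalg_funP t.
rewrite sweedler_midE_right -tD (tmap_compE (h := t) (i := mid_map h \o t)) //.
rewrite (tmap_compE (h := t) (i := mid_map h \o t)) // => w.
rewrite -[RHS]/(tmap h idfun (comul P (t w))) -tD.
by rewrite [RHS](tmap_compE (h := h \o t) (i := t)).
Qed.

(** The map a ⊗ b ⊗ c |-> ε(a) ε(c) b; it recovers h x from the middle factor. *)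
Definition contract_ends : {linear tensor P (tensor Q P) -> Q} :=
  contractl Q \o tmap (counit P) (contractr Q \o tmap idfun (counit P)).

Lemma contract_ends_mid h x : contract_ends (sweedler_mid h x) = h x.
Proof.
rewrite -[LHS]/(contractl Q (tmap (counit P)
  (contractr Q \o tmap idfun (counit P)) (sweedler_mid h x))).
rewrite sweedler_midE_right (tmap_compE (h := counit P) (i := h)) //.
  rewrite -(tmap_compE (f := counit P) (f' := idfun) (g := idfun) (g' := h)) //.
  by rewrite counitl tmapE contractl1.
move=> w; rewrite -[LHS]/(contractr Q (tmap idfun (counit P)
  (tmap h idfun (comul P w)))).
rewrite (tmap_compE (h := h) (i := counit P)) //.
rewrite -(tmap_compE (f := idfun) (f' := h) (g := counit P) (g' := idfun)) //.
by rewrite counitr tmapE contractr1.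
Qed.

End SweedlerMid.

(** * The Sweedler equalizer *)

Section SweedlerEqualizerTheory.
Variables (k : fieldType) (P Q : coalg k) (f g : coalg_hom P Q).
Local Notation D := (sweedler_eq f g).
Local Notation e := (sweedler_eq_incl f g).

Lemma sweedler_eqP x :
  reflect (sweedler_mid f x = sweedler_mid g x) (x \in sweedler_eq_pred f g).
Proof. exact: eqP. Qed.

Lemma sweedler_eq_incl_inj : injective e.
Proof. exact: val_inj. Qed.

Lemma sweedler_mid_incl d : sweedler_mid f (e d) = sweedler_mid g (e d).
Proof. by apply/sweedler_eqP; exact: valP. Qed.

Lemma sweedler_eq_equalizes d : f (e d) = g (e d).
Proof.
by rewrite -(contract_ends_mid f) -(contract_ends_mid g) sweedler_mid_incl.
Qed.

Lemma sweedler_eq_lift (Y : coalg k) (t : coalg_hom Y P) :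
  (forall y, f (t y) = g (t y)) -> forall y, t y \in sweedler_eq_pred f g.
Proof.
move=> ftgt y; apply/sweedler_eqP; rewrite !sweedler_mid_nat.
by apply: eq_tmap => //; apply: eq_tmap.
Qed.

(** The retraction is 1 - s M, where M is the difference of the two defining
    maps and M s M = M.  Since M ⊗ id and id ⊗ M kill Δ (e d), this projection
    fixes Δ (e d) in each of its two factors. *)
Lemma sweedler_eq_retraction : exists r : {linear P -> D},
  cancel e r /\
  forall d, tmap e e (tmap r r (comul P (e d))) = comul P (e d).
Proof.
pose M : {linear P -> _} := sweedler_mid f \- sweedler_mid g.
have [s MsM] := exists_pseudoinverse M.
have Me d : M (e d) = 0 by apply/eqP; rewrite subr_eq0 sweedler_mid_incl.
pose pi : {linear P -> P} := idfun \- (s \o M).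
have piD x : pi x \in sweedler_eq_pred f g.
  apply/sweedler_eqP; apply: subr0_eq; rewrite -[LHS]/(M (pi x)).
  by rewrite [pi _]/= linearB MsM subrr.
pose r0 x : D := Sub (pi x) (piD x).
have r0L : linear r0.
  move=> a x y; apply: sweedler_eq_incl_inj.
  by rewrite -[LHS]/(pi (a *: x + y)) [RHS]linearP linearP.
pose r : {linear P -> D} := HB.pack r0 (GRing.isLinear.Build k P D *:%R r0 r0L).
have er x : e (r x) = pi x by [].
exists r; split=> d.
  apply: sweedler_eq_incl_inj.
  by rewrite -[LHS]/(e d - s (M (e d))) Me linear0 subr0.
rewrite (tmap_compE (h := pi) (i := pi)) //.
have fg := sweedler_mid_incl d.
have Ml : tmap M idfun (comul P (e d)) = 0.
  by rewrite tmapBl !sweedler_mid_comull fg subrr.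
have Mr : tmap idfun M (comul P (e d)) = 0.
  by rewrite tmapBr !sweedler_mid_comulr fg subrr.
have pil : tmap pi idfun (comul P (e d)) = comul P (e d).
  rewrite tmapBl tmap_id -(tmap_compE (f := M) (f' := s) (h := s \o M)
    (g := idfun) (g' := idfun) (i := idfun)) //.
  by rewrite Ml linear0 subr0.
have pir : tmap idfun pi (comul P (e d)) = comul P (e d).
  rewrite tmapBr tmap_id -(tmap_compE (f := idfun) (f' := idfun) (h := idfun)
    (g := M) (g' := s) (i := s \o M)) //.
  by rewrite Mr linear0 subr0.
rewrite -(tmap_compE (f := pi) (f' := idfun) (h := pi)
  (g := idfun) (g' := pi) (i := pi)) //.
by rewrite pil pir.
Qed.

End SweedlerEqualizerTheory.

Section Corestriction.
Variables (k : fieldType) (P Q : coalg k) (f g : coalg_hom P Q).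
Variable sD : coalg_struct (sweedler_eq f g).
Hypothesis he : is_coalg_map sD P (sweedler_eq_incl f g).

(** By [sweedler_eq_lift] the values of t lie in the equalizer; compatibility
    with the comultiplications holds after applying the injection e ⊗ e. *)
Lemma sweedler_eq_corestrict (Y : coalg k) (t : coalg_hom Y P) :
    (forall y, f (t y) = g (t y)) ->
  exists t' : coalg_hom Y (Coalg sD), forall y, sweedler_eq_incl f g (t' y) = t y.
Proof.
move=> ftgt; have tD := sweedler_eq_lift ftgt.
pose t0 y : sweedler_eq f g := Sub (t y) (tD y).
have t0L : linear t0.
  move=> a x y; apply: sweedler_eq_incl_inj.
  by rewrite -[LHS]/(t (a *: x + y)) [RHS]linearP linearP.
pose t1 : {linear Y -> sweedler_eq f g} :=
  HB.pack t0 (GRing.isLinear.Build k Y (sweedler_eq f g) *:%R t0 t0L).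
have [r [eK _]] := sweedler_eq_retraction f g.
have [he1 he2] := he; have [tm1 tm2] := coalg_funP t.
have t1P : is_coalg_map Y (Coalg sD) t1.
  split=> y; last by rewrite -he2 -tm2.
  apply: (can_inj (tmap_cancel eK eK)).
  by rewrite (tmap_compE (h := t) (i := t)) // tm1 [RHS]he1.
by exists (CoalgHom t1P).
Qed.

End Corestriction.

Theorem mainTheorem4
  (k : fieldType) (J : category) (F : functor J (CoAlg k))
  (P : CoAlg k) (p : forall j : J, mor P (F j))
  (hP : is_product p)
  (Q : CoAlg k) (q : forall u : arrow J, mor Q (F (cod u)))
  (hQ : is_product q)
  (f g : mor P Q)
  (hf : forall u : arrow J, q u ∘ f = p (cod u))
  (hg : forall u : arrow J, q u ∘ g = fmap F u ∘ p (dom u)) :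
  let e := sweedler_eq_incl f g in
  (exists! sD : coalg_struct (sweedler_eq f g), is_coalg_map sD P e) /\
  forall (sD : coalg_struct (sweedler_eq f g)) (he : is_coalg_map sD P e),
    let D : CoAlg k := Coalg sD in
    let eD : mor D P := @CoalgHom k (Coalg sD) P e he in
    is_limit (L := D) (fun j : J => p j ∘ eD).
Proof.
move=> e; split.
  have [r [eK stab]] := sweedler_eq_retraction f g.
  have [sD he] := subcoalgebra_exists eK stab.
  by exists sD; split=> // sD' he'; exact: coalg_struct_uniq eK _ _ he he'.
move=> sD he D eD; split=> [a b u|Y psi psiC].
  (* The cone identity is q_v f e = q_v g e for the arrow v = u. *)
  pose v := Arrow u.
  have feD : f ∘ eD = g ∘ eD.
    by apply: coalg_hom_ext => d; exact: sweedler_eq_equalizes.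
  have := congr1 (fun h => q v ∘ h) feD.
  by rewrite !compmA hf hg => ->.
have [t [tp tuniq]] := hP Y psi.
have ftgt : f ∘ t = g ∘ t.
  have [w [_ wuniq]] := hQ Y (fun u => psi (cod u)).
  apply: (etrans (y := w)).
    by symmetry; apply: wuniq => u; rewrite compmA hf.
  by apply: wuniq => u; rewrite compmA hg -compmA tp psiC.
have [t' t'P] : exists t' : mor Y D, eD ∘ t' = t.
  have [y|t' t'E] := @sweedler_eq_corestrict k P Q f g sD he Y t.
    exact: (congr1 (fun h : coalg_hom Y Q => h y) ftgt).
  by exists t'; exact: coalg_hom_ext.
exists t'; split=> [j|t'' t''P]; first by rewrite -compmA t'P tp.
have et : eD ∘ t' = eD ∘ t''.
  by rewrite t'P; apply: tuniq => j; rewrite compmA t''P.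
apply: coalg_hom_ext => y; apply: (@sweedler_eq_incl_inj k P Q f g).
exact: (congr1 (fun h : coalg_hom Y P => h y) et).
Qed.
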